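(* Let $\mathcal{C}$ be the class of all finite groups that are both minimal non-Iwasawa groups and modular groups. Then $\mathcal{C}$ is contained in the class of minimal non-cyclic groups; that is, every group $G\in\mathcal{C}$ is non-cyclic and all of its proper subgroups are cyclic.
   Context: All groups are finite. $L(G)$ denotes the lattice of all subgroups of a group $G$. A subgroup $H$ of $G$ is permutable if $HK=KH$ for all $K\in L(G)$. $G$ is an Iwasawa group if all its subgroups are permutable. $G$ is a modular group if the lattice $L(G)$ is modular. For a class of groups $\mathcal{X}$, a group $G$ is a minimal non-$\mathcal{X}$ group if $G\notin\mathcal{X}$ but all proper subgroups of $G$ belong to $\mathcal{X}$. *)

(* Defs.v *)
From mathcomp Require Import all_boot all_fingroup all_solvable.

Set Implicit Arguments.
Unset Strict Implicit.
Unset Printing Implicit Defensive.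

Import GroupScope.

(* Classes of finite groups.  A group is a [G : {group gT}], so a class is a
   predicate uniform in the ambient type [gT]. *)
Definition group_class := forall gT : finGroupType, {group gT} -> bool.

(* L(G) is [subgroups G : {set {group gT}}]; [H * K] is the elementwise
   product set {hk | h in H, k in K}. *)
Definition permutable (gT : finGroupType) (H G : {group gT}) : bool :=
  (H \in subgroups G) && [forall K in subgroups G, H * K == K * H].

Definition iwasawa : group_class :=
  fun gT G => [forall H in subgroups G, permutable H G].

(* The modular law in L(G), whose join and meet are [<*>] and [:&:]. *)
Definition modular_group : group_class :=
  fun gT G =>
    [forall X in subgroups G, forall Y in subgroups G,
      forall Z in subgroups G,
        (X \subset Z) ==> (X <*> (Y :&: Z) == (X <*> Y) :&: Z)].

Definition cyclic_group : group_class := fun gT G => cyclic G.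

Definition minimal_non (X : group_class) : group_class :=
  fun gT G => ~~ X gT G && [forall H : {group gT}, (H \proper G) ==> X gT H].

(* Main.v *)
(* An Iwasawa group is nilpotent: a permutable maximal subgroup is normal.
   Conversely, if G is nilpotent and modular with Iwasawa proper subgroups, take
   X, Y with <X, Y> = G and a (normal) maximal M containing X; the modular law
   gives X(Y :&: M) = M, hence XY = MY = G.  So the G of the theorem is not
   nilpotent and has a non-normal maximal subgroup M.  For x in G \ M the
   subgroup D = M :&: M^x is maximal in M and in M^x (modularity), hence normal
   in both and so in G.  For y in M \ M^x one gets <y, y^x> = G, since G/D is not
   nilpotent, and the modular law yields M = <y, <y^x> :&: D>.  Choosing y of
   q-power order shows that M is a q-group; choosing x of order prime to q, which
   centralises D, gives M = <y>.  Finally M meets any q'-subgroup P trivially, so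
   for 1 <> x in P the modular law gives P = <x>(M :&: P) = <x>.  Hence all Sylow
   subgroups of G are cyclic, and so are its nilpotent subgroups. *)
Require Import Defs.
From mathcomp Require Import all_boot all_fingroup all_solvable.

Set Implicit Arguments.
Unset Strict Implicit.
Unset Printing Implicit Defensive.

Import GroupScope.

(** * Maximal subgroups, normality and nilpotency *)

Lemma nilpotent_maximal_normal (gT : finGroupType) (G M : {group gT}) :
  nilpotent G -> maximal M G -> M <| G.
Proof.
move=> nilG maxM; have [ltMG maxM'] := maxgroupP maxM.
have sMG := proper_sub ltMG.
have sMN : M \subset 'N_G(M) by rewrite subsetI sMG normG.
have [|/maxM' eqNM] := eqVproper (subsetIl G 'N(M)).
  by rewrite /normal sMG => /setIidPl.
have := nilpotent_proper_norm nilG ltMG.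
by rewrite eqNM // properxx.
Qed.

Lemma maximal_normal_nilpotent (gT : finGroupType) (G : {group gT}) :
  (forall M : {group gT}, maximal M G -> M <| G) -> nilpotent G.
Proof.
move=> nMax; suff sGF : G \subset 'F(G) by apply: nilpotentS sGF (Fitting_nil G).
rewrite -{1}(Sylow_gen G) gen_subG.
apply/bigcupsP=> P /SylowP[p pr_p sylP].
have nPG : P <| G.
  rewrite /normal (pHall_sub sylP).
  (* If [P] is not normal, its normaliser lies in some maximal [M]. As [M] is normal, the Frattini
     argument gives [G = M * 'N_G(P) = M], which is absurd. *)
  have [/= <-|[M maxM sNM]] := maximal_exists (subsetIl G 'N(P)).
    exact: subsetIr.
  have sPM : P \subset M.
    by apply: subset_trans sNM; rewrite subsetI (pHall_sub sylP) normG.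
  have sylPM := pHall_subl sPM (proper_sub (maxgroupp maxM)) sylP.
  have := Frattini_arg (nMax M maxM) sylPM.
  rewrite mulGSid // => eqMG.
  by have := maxgroupp maxM; rewrite eqMG properxx.
exact: Fitting_max nPG (pgroup_nil (pHall_pgroup sylP)).
Qed.

(** A non-normal maximal subgroup is its own normaliser. *)
Lemma nonnormal_maximalJ (gT : finGroupType) (G M : {group gT}) (x : gT) :
  maximal M G -> ~~ (M <| G) -> x \in G -> M :^ x = M -> x \in M.
Proof.
move=> maxM nnM Gx eqMx; have [ltMG maxM'] := maxgroupP maxM.
have sMG := proper_sub ltMG.
have sMN : M \subset 'N_G(M) by rewrite subsetI sMG normG.
have [eqN|/maxM' eqNM] := eqVproper (subsetIl G 'N(M)).
  by case/negP: nnM; rewrite /normal sMG; apply/setIidPl.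
by rewrite -(eqNM sMN) inE Gx; apply/normP.
Qed.

Lemma joing_maximal (gT : finGroupType) (G M N : {group gT}) :
  maximal M G -> N \subset G -> ~~ (N \subset M) -> M <*> N = G.
Proof.
move=> maxM sNG nsNM; have [ltMG maxM'] := maxgroupP maxM.
have sMNG : M <*> N \subset G by rewrite join_subG proper_sub.
have [//|/maxM' eqMN] := eqVproper sMNG.
by case/negP: nsNM; rewrite -(eqMN (joing_subl _ _)) joing_subr.
Qed.

(** * Iwasawa groups versus nilpotent modular groups *)

Lemma iwasawaP (gT : finGroupType) (G : {group gT}) :
  reflect (forall H K : {group gT}, H \subset G -> K \subset G ->
             H * K = K * H)
          (iwasawa G).
Proof.
apply: (iffP forall_inP) => [iwG H K sHG sKG | comG H sHG].
  have /andP[_ /forall_inP/(_ K)] : permutable H G by apply: iwG; rewrite inE.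
  by rewrite inE => /(_ sKG)/eqP.
rewrite /permutable sHG; apply/forall_inP=> K sKG; apply/eqP.
by rewrite !inE in sHG sKG; apply: comG.
Qed.

Lemma modular_groupP (gT : finGroupType) (G : {group gT}) :
  reflect (forall X Y Z : {group gT}, X \subset G -> Y \subset G ->
             Z \subset G -> X \subset Z -> X <*> (Y :&: Z) = (X <*> Y) :&: Z)
          (modular_group G).
Proof.
apply: (iffP forall_inP) => [modG X Y Z sX sY sZ sXZ | modG X sX].
  have /modG/forall_inP/(_ Y) : X \in subgroups G by rewrite inE.
  rewrite inE => /(_ sY)/forall_inP/(_ Z); rewrite inE => /(_ sZ).
  by rewrite sXZ => /eqP.
apply/forall_inP=> Y sY; apply/forall_inP=> Z sZ.
by rewrite !inE in sX sY sZ; apply/implyP=> sXZ; apply/eqP/modG.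
Qed.

Lemma iwasawa_nilpotent (gT : finGroupType) (G : {group gT}) :
  iwasawa G -> nilpotent G.
Proof.
move/iwasawaP=> comG; apply: maximal_normal_nilpotent => M maxM.
have sMG := proper_sub (maxgroupp maxM).
rewrite /normal sMG; apply/subsetP=> x Gx; apply/normP.
have sMxG : M :^ x \subset G by rewrite conj_subG.
apply/eqP; rewrite eqEcard cardJg leqnn andbT.
apply/negPn/negP=> nsMxM.
have /= defG := joing_maximal maxM sMxG nsMxM.
have /= comM := comG M (M :^ x)%G sMG sMxG.
(* Permutability gives [G = M * M :^ x], so [x = m * k ^ x] with [m] and [k] in [M]. Cancelling the
   last [x] leaves [x = k * m], so [x] lies in [M]. *)
move: Gx; rewrite -defG comm_joingE // => /mulsgP[m _ Mm /imsetP[k Mk ->]].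
rewrite conjgE !mulgA -{1}[x]mul1g => /mulIg/esym/(canRL (mulgK _)).
rewrite mul1g => /(canRL (mulKg _)) /(canRL invgK) eqx.
have Mx : x \in M by rewrite eqx invMg !invgK groupM.
by case/negP: nsMxM; rewrite conjGid.
Qed.

Lemma nilpotent_modular_iwasawa (gT : finGroupType) (G : {group gT}) :
    (forall M : {group gT}, M \proper G -> iwasawa M) ->
  modular_group G -> nilpotent G -> iwasawa G.
Proof.
move=> iwM /modular_groupP modG nilG.
suff sub (X Y : {group gT}) : X \subset G -> Y \subset G -> Y * X \subset X * Y.
  apply/iwasawaP=> X Y sXG sYG; apply/eqP.
  by rewrite eqEsubset !sub.
move=> sXG sYG.
have sXYG : X <*> Y \subset G by rewrite join_subG sXG.
have [defG|ltXYG] := eqVproper sXYG; last first.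
  by rewrite ((iwasawaP _ (iwM _ ltXYG)) Y X) ?joing_subl ?joing_subr.
have [eqXG|[M maxM sXM]] := maximal_exists sXG.
  by rewrite eqXG (mulGSid sYG) (mulSGid sYG).
have ltMG := maxgroupp maxM; have sMG := proper_sub ltMG.
have nsYM : ~~ (Y \subset M).
  apply/negP=> sYM; move: ltMG; rewrite properE sMG -defG join_subG.
  by rewrite sXM sYM.
have nMG := nilpotent_maximal_normal nilG maxM.
have defM : X * (Y :&: M) = M.
  rewrite -comm_joingE; first by rewrite modG // defG; apply/setIidPr.
  exact: (iwasawaP _ (iwM _ ltMG)) X (Y :&: M)%G sXM (subsetIr _ _).
(* [G = M * Y = X * (Y :&: M) * Y = X * Y], the first equality because [M] is normal and maximal. *)
have -> : X * Y = G.
  have /= defG' := mulg_normal_maximal nMG maxM sYG nsYM.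
  by rewrite -[RHS]defG' -{1}defM -mulgA [(_ :&: _) * _]mulSGid ?subsetIl.
by rewrite mul_subG.
Qed.

(** * Intersections and quotients at maximal subgroups *)

Lemma modular_maximalI (gT : finGroupType) (G M N : {group gT}) :
    modular_group G -> maximal M G -> maximal N G -> ~~ (M \subset N) ->
  maximal (M :&: N) M.
Proof.
move=> /modular_groupP modG maxM maxN nsMN.
have sMG := proper_sub (maxgroupp maxM).
have sNG := proper_sub (maxgroupp maxN).
apply/maxgroupP; split=> [|E ltEM sDE].
  by rewrite properE subsetIl subsetI subxx.
have sEM := proper_sub ltEM; have sEG := subset_trans sEM sMG.
(* Since [E] contains [M :&: N], the modular law reads [E = (E <*> N) :&: M]. If [E] is not inside
   [N], the join is [G], forcing [E = M]. *)
have /= := modG E N M sEG sNG sMG sEM.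
rewrite (joing_idPl _) => [eqE|]; last by rewrite setIC.
have [sEN|nsEN] := boolP (E \subset N).
  by apply/eqP; rewrite eqEsubset sDE subsetI sEM sEN.
have defG : E <*> N = G by rewrite joingC (joing_maximal maxN).
by move: ltEM; rewrite eqE defG (setIidPr sMG) properxx.
Qed.

(** If [H <*> D] were [G], then [G / D = H / D] would be nilpotent, making [M / D], and hence [M],
    normal. So [H <*> D] is proper, and maximality of [M] applies. *)
Lemma quotient_maximal_nonnil (gT : finGroupType) (G M D H : {group gT}) :
    maximal M G -> ~~ (M <| G) -> D <| G -> D \subset M ->
    H \subset G -> nilpotent (H / D) -> M \subset H <*> D ->
  H <*> D = M.
Proof.
move=> maxM nnM nDG sDM sHG nilH sMHD.
have sMG := proper_sub (maxgroupp maxM).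
have sHDG : H <*> D \subset G by rewrite join_subG sHG normal_sub.
have [defG|ltHD] := eqVproper sHDG; last first.
  by have [_ /(_ _ ltHD sMHD)] := maxgroupP maxM.
case/negP: nnM.
have nDM : D <| M := normalS sDM sMG nDG.
rewrite -(quotientGK nDM) -(quotientGK nDG) cosetpre_normal.
apply: nilpotent_maximal_normal; last by rewrite quotient_maximal.
by rewrite /= -defG quotientYidr // (subset_trans sHG) ?normal_norm.
Qed.

(** * Modular groups with a non-normal maximal subgroup and nilpotent proper subgroups *)

Section NonnilpotentModular.

Variables (gT : finGroupType) (G M : {group gT}).
Hypotheses (modG : modular_group G) (maxM : maximal M G) (nnM : ~~ (M <| G)).
Hypothesis nilG : forall H : {group gT}, H \proper G -> nilpotent H.

Let sMG : M \subset G := proper_sub (maxgroupp maxM).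

Let nsMJ x : x \in G -> x \notin M -> ~~ (M :^ x \subset M).
Proof.
move=> Gx; apply: contra => sMxM.
apply: nonnormal_maximalJ maxM nnM Gx _; apply/eqP.
by rewrite eqEcard sMxM cardJg leqnn.
Qed.

Let nsMJV x : x \in G -> x \notin M -> ~~ (M \subset M :^ x).
Proof.
by move=> Gx nMx; rewrite -sub_conjgV nsMJ ?groupV.
Qed.

Let maxMJ x : x \in G -> maximal (M :^ x) G.
Proof. by move=> Gx; rewrite -(conjGid Gx) maximalJ. Qed.

Lemma maximal_conjI x : x \in G -> x \notin M -> maximal (M :&: M :^ x) M.
Proof.
move=> Gx nMx.
by apply: (@modular_maximalI _ G M (M :^ x)%G) => //; [apply: maxMJ | apply: nsMJV].
Qed.

Lemma normal_conjI x : x \in G -> x \notin M -> M :&: M :^ x <| G.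
Proof.
move=> Gx nMx; have sMxG := proper_sub (maxgroupp (maxMJ Gx)).
have nM := nilpotent_maximal_normal (nilG (maxgroupp maxM)) (maximal_conjI Gx nMx).
have nMx' : M :^ x :&: M <| M :^ x.
  apply: (@nilpotent_maximal_normal _ (M :^ x)%G (M :^ x :&: M)%G).
    exact: nilG (maxgroupp (maxMJ Gx)).
  by apply: (@modular_maximalI _ G (M :^ x)%G M) => //; [apply: maxMJ | apply: nsMJ].
rewrite /normal subIset ?sMG //=.
have /= <- := joing_maximal maxM sMxG (nsMJ Gx nMx).
by rewrite join_subG normal_norm //= setIC normal_norm.
Qed.

Lemma maximal_join_cycleI x y :
    x \in G -> x \notin M -> y \in M -> y \notin M :^ x ->
  M = <[y]> <*> (<[y ^ x]> :&: (M :&: M :^ x)) :> {set gT}.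
Proof.
move=> Gx nMx My nMxy; set D := M :&: M :^ x.
have maxD : maximal D M := maximal_conjI Gx nMx.
have nDG : D <| G := normal_conjI Gx nMx.
have Gy := subsetP sMG y My; have Gyx : y ^ x \in G by rewrite groupJ.
have sYG : <[y]> \subset G by rewrite cycle_subG.
have sYxG : <[y ^ x]> \subset G by rewrite cycle_subG.
have sYM : <[y]> \subset M by rewrite cycle_subG.
have defM : <[y]> <*> D = M.
  rewrite joingC; apply: (@joing_maximal _ M (M :&: M :^ x)%G <[y]>%G) => //.
  by rewrite cycle_subG inE My.
have defMx : <[y ^ x]> <*> D = M :^ x.
  by rewrite -[in RHS]defM conjYg -cycleJ (normsP (normal_norm nDG)).
(* Otherwise this join is nilpotent, and its join with [D] equals [M] by the quotient lemma; but it
   also contains [M :^ x]. *)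
have defG : <[y]> <*> <[y ^ x]> = G.
  have sHG : <[y]> <*> <[y ^ x]> \subset G by rewrite join_subG sYG.
  have [//|ltHG] := eqVproper sHG.
  have sMHD : M \subset <[y]> <*> <[y ^ x]> <*> D.
    by rewrite -{1}defM genS // setSU // joing_subl.
  have /= eqM := @quotient_maximal_nonnil _ G M (M :&: M :^ x)%G
    (<[y]> <*> <[y ^ x]>)%G maxM nnM nDG (subsetIl _ _) sHG
    (quotient_nil _ (nilG ltHG)) sMHD.
  case/negP: (nsMJ Gx nMx); rewrite /= -defMx.
  apply: subset_trans (_ : <[y]> <*> <[y ^ x]> <*> D \subset M); last by rewrite eqM.
  by rewrite genS // setSU // joing_subr.
have /= := modular_groupP _ modG <[y]>%G <[y ^ x]>%G M sYG sYxG sMG sYM.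
rewrite defG (setIidPr sMG) => {1}<-; congr (_ <*> _).
(* As [y ^ x] lies in [M :^ x], intersecting [<[y ^ x]>] with [M] or with [D] gives the same
   subgroup. *)
rewrite /D setIA; apply/esym/setIidPl; rewrite subIset //.
by rewrite cycle_subG memJ_conjg My.
Qed.

Lemma maximal_pgroup : exists2 q : nat, prime q & q.-group M.
Proof.
have [x Gx nMx] : exists2 x, x \in G & x \notin M.
  by apply/subsetPn; case/andP: (maxgroupp maxM).
have [Q /SylowP[q pr_q sylQ] nsQ] :
    exists2 Q : {group gT}, Sylow M Q & ~~ (Q \subset M :^ x).
  have [/forall_inP sM|] := boolP [forall (Q : {group gT} | Sylow M Q), Q \subset M :^ x].
    case/negP: (nsMJV Gx nMx); rewrite -{1}(Sylow_gen M) gen_subG.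
    by apply/bigcupsP.
  by rewrite negb_forall => /existsP[Q]; rewrite negb_imply => /andP[]; exists Q.
exists q => //; have [y Qy nMxy] := subsetPn nsQ.
have My := subsetP (pHall_sub sylQ) y Qy.
have q_y : q.-elt y := mem_p_elt (pHall_pgroup sylQ) Qy.
have nilM : nilpotent M := nilG (maxgroupp maxM).
have [sQM q_Q _] := and3P sylQ.
(* Both subgroups generating [M] are [q]-groups, so in the nilpotent group [M] they lie in
   ['O_q(M)]. *)
suff sMO : M \subset 'O_q(M) by apply: pgroupS sMO (pcore_pgroup q M).
rewrite {1}(maximal_join_cycleI Gx nMx My nMxy) join_subG.
rewrite !(sub_Hall_pcore (nilpotent_pcore_Hall q nilM)) ?cycle_subG //.
  by apply/andP; split=> //; apply: pgroupS (subsetIl _ _) _; rewrite /pgroup -orderE orderJ.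
by rewrite /= setICA subsetIl.
Qed.

Lemma maximal_cyclic x q : prime q -> q.-group M ->
  x \in G -> q^'.-elt x -> x \notin M -> cyclic M.
Proof.
move=> pr_q q_M Gx q'x nMx; set D := M :&: M :^ x.
have nDG : D <| G := normal_conjI Gx nMx.
have [y My nMxy] := subsetPn (nsMJV Gx nMx).
have sXG : <[x]> \subset G by rewrite cycle_subG.
(* [<[x]> <*> D] is proper, since [G / D] is not cyclic. Hence it is nilpotent, and its subgroups
   [D] and [<[x]>] of coprime orders commute. *)
have cDx : D \subset 'C(<[x]>).
  have sXDG : <[x]> <*> D \subset G by rewrite join_subG sXG normal_sub.
  have ltXDG : <[x]> <*> D \proper G.
    rewrite properEneq sXDG andbT; apply/eqP=> defG.
    have /= eqM := @quotient_maximal_nonnil _ G M (M :&: M :^ x)%G <[x]>%G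
      maxM nnM nDG (subsetIl _ _) sXG (quotient_nil _ (abelian_nil (cycle_abelian x))).
    by move: nMx; rewrite -eqM ?defG ?Gx.
  apply: (@sub_nilpotent_cent2 _ (M :&: M :^ x)%G <[x]>%G _ (nilG ltXDG)).
  - exact: joing_subl.
  - exact: joing_subr.
  by rewrite coprime_sym; apply: pnat_coprime (pgroupS (subsetIl _ _) q_M) q'x.
apply/cyclicP; exists y; rewrite {1}(maximal_join_cycleI Gx nMx My nMxy).
(* An element [z] of [<[y]> :^ x] that commutes with [x] already lies in [<[y]>]. *)
apply/joing_idPl; apply/subsetP=> z /setIP[yxz Dz].
have := yxz; rewrite cycleJ mem_conjg /conjg invgK.
have /centP/(_ x (cycle_id x)) czx := subsetP cDx z Dz.
by rewrite mulgA -czx mulgK.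
Qed.

Lemma sub_p'group_cyclic q (P : {group gT}) :
  q.-group M -> P \subset G -> q^'.-group P -> cyclic P.
Proof.
move=> q_M sPG q'P.
have [->|/trivgPn[x Px nt_x]] := eqVneq P 1%G; first exact: cyclic1.
have tiMP : M :&: P = 1 by apply: coprime_TIg; apply: pnat_coprime q_M q'P.
have sXP : <[x]> \subset P by rewrite cycle_subG.
have sXG := subset_trans sXP sPG.
have nsXM : ~~ (<[x]> \subset M).
  rewrite cycle_subG; apply: contra nt_x => Mx.
  by rewrite -in_set1 -[[set 1]]/[1 gT] -tiMP inE Mx.
have /= := modular_groupP _ modG <[x]>%G M P sXG sMG sPG sXP.
rewrite tiMP joingG1 [<[x]> <*> M]joingC (joing_maximal maxM sXG nsXM).
by rewrite (setIidPr sPG) => <-; apply: cycle_cyclic.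
Qed.

Lemma nonnilpotent_modular_Zgroup : Zgroup G.
Proof.
have [q pr_q q_M] := maximal_pgroup.
(* By maximality, a Sylow [q]-subgroup above [M] is [M] or [G]; in the latter case [M] would be
   normal. *)
have sylM : q.-Sylow(G) M.
  have [Q sylQ sMQ] := Sylow_superset sMG q_M.
  have [eqQG|ltQG] := eqVproper (pHall_sub sylQ).
    case/negP: nnM; apply: p_maximal_normal maxM.
    by rewrite -eqQG; apply: pHall_pgroup sylQ.
  by have [_ /(_ _ ltQG sMQ) <-] := maxgroupP maxM.
have cycM : cyclic M.
  (* A prime divisor [p] of the index differs from [q], so an element of order [p] serves as the [x]
     of [maximal_cyclic]. *)
  have [_ _ q'i] := and3P sylM; set p := pdiv #|G : M|.
  have i_gt1 : 1 < #|G : M| by rewrite indexg_gt1; case/andP: (maxgroupp maxM).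
  have pr_p : prime p := pdiv_prime i_gt1.
  have q'p : p \in q^' by apply: pnatPpi q'i _; rewrite pi_pdiv.
  have [|x Gx ox] := Cauchy pr_p (_ : p %| #|G|).
    exact: dvdn_trans (pdiv_dvd _) (dvdn_indexg _ _).
  have q'x : q^'.-elt x by rewrite /p_elt ox pnatE.
  apply: (maximal_cyclic pr_q q_M Gx q'x); apply/negP=> Mx.
  have := pnat_1 (mem_p_elt q_M Mx) q'x; rewrite ox => p1.
  by rewrite p1 in pr_p.
apply/forall_inP=> P /SylowP[p pr_p sylP].
have [eq_pq|neq_pq] := eqVneq p q.
  rewrite eq_pq in sylP; have [x _ ->] := Sylow_trans sylM sylP.
  by rewrite cyclicJ.
apply: (sub_p'group_cyclic q_M (pHall_sub sylP)).
by apply: sub_in_pnat (pHall_pgroup sylP) => r _ /eqnP->.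
Qed.

End NonnilpotentModular.

Theorem corollary3 (gT : finGroupType) (G : {group gT})
    (minG : minimal_non iwasawa G) (modG : modular_group G) :
  minimal_non cyclic_group G.
Proof.
have [niwG /forall_inP iwM] := andP minG.
have nilM (H : {group gT}) : H \proper G -> nilpotent H by move/iwM/iwasawa_nilpotent.
have nnilG : ~~ nilpotent G.
  by apply: contra niwG; apply: nilpotent_modular_iwasawa.
have [M maxM nnM] : exists2 M : {group gT}, maximal M G & ~~ (M <| G).
  have [/forall_inP nMax|] := boolP [forall (M : {group gT} | maximal M G), M <| G].
    by case/negP: nnilG; apply: maximal_normal_nilpotent.
  by rewrite negb_forall => /existsP[M]; rewrite negb_imply => /andP[]; exists M.
have zG := nonnilpotent_modular_Zgroup modG maxM nnM nilM.
apply/andP; split.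
  by apply: contra nnilG => /cyclic_abelian/abelian_nil.
apply/forall_inP=> H ltHG.
exact: nil_Zgroup_cyclic (ZgroupS (proper_sub ltHG) zG) (nilM H ltHG).
Qed.
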